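(* Let $n\ge 1$, let $h$ be one of the Hamiltonians $$\Delta_{l;k}/\Delta'_{l;l-k}\ (1\le k<l\le n),\qquad \Delta_l\ (1\le l\le n)$$ of the Gelfand--Zeitlin integrable system on $(M_n,\pi_n)$, and let $X_0\in M_n\setminus D_n$. Then there exists a curve $\gamma\colon\mathbb{C}\to M_n$ whose entry functions $\gamma_{ij}(t)$ are given by $$\sum_{p=1}^N (c^p_{ij}+d^p_{ij}t)\,e^{\alpha^p_{ij}t}+(b_{ij}+c_{ij}t+d_{ij}t^2)$$ for some integer $N$ and some $b_{ij},c_{ij},d_{ij},c^p_{ij},d^p_{ij}\in\mathbb{C}$, $\alpha^p_{ij}\in\mathbb{C}^*$ depending on $X_0$, with the following properties: 1. $\gamma^{-1}(D_n)$ is a discrete subset of $\mathbb{C}$; and 2. $\gamma\colon\mathbb{C}\setminus\gamma^{-1}(D_n)\to M_n$ is the integral curve of the Hamiltonian $h$ such that $\gamma(0)=X_0$.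
   Context: $M_n$ is the space of complex $n\times n$ matrices with coordinate functions $x_{ij}$, equipped with the quadratic Poisson structure $$\pi_n=\sum_{i,k=1}^n\sum_{j,l=1}^n(\mathrm{sign}(k-i)+\mathrm{sign}(l-j))\,x_{il}x_{kj}\,\frac{\partial}{\partial x_{ij}}\wedge\frac{\partial}{\partial x_{kl}},$$ where $\mathrm{sign}(a)=1,0,-1$ according to $a>0$, $a=0$, $a<0$; the bracket is normalized by $\{x_{ij},x_{kl}\}=(\mathrm{sign}(k-i)+\mathrm{sign}(l-j))x_{il}x_{kj}$ and extended to rational functions. For index sets $I,J$ with $|I|=|J|$, $\Delta_{I,J}(X)$ is the determinant of the submatrix of $X$ with rows $I$ and columns $J$; $[a,b]=\{a,a+1,\ldots,b\}$. For $1\le k<l\le n$ put $\Delta_{l;k}=\Delta_{[1,k],[l-k+1,l]}$ and $\Delta'_{l;k}=\Delta_{[l-k+1,l],[1,k]}$ (the upper-right and lower-left $k\times k$ minors of the leading principal $l\times l$ submatrix), and for $1\le l\le n$ put $\Delta_l=\Delta_{[1,l],[1,l]}$. The singular locus is $$D_n=\{X\in M_n\mid \Delta'_{l;k}(X)=0\text{ for some }1\le k<l\le n\}.$$ All the listed Hamiltonians are regular on $M_n\setminus D_n$. An integral curve of $h$ is a holomorphic (complex time) curve in $M_n \setminus D_n$ satisfying $x_{ij}'(t)=\{x_{ij},h\}(X(t))$ for all $i,j$. *)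

(* Defs.v *)
From mathcomp Require Import all_boot all_order all_algebra.
From mathcomp Require Import complex.
From mathcomp Require Import all_classical all_reals all_analysis.

Set Implicit Arguments.
Unset Strict Implicit.
Unset Printing Implicit Defensive.

Import Order.TTheory GRing.Theory Num.Theory numFieldNormedType.Exports.

Local Open Scope classical_set_scope.
Local Open Scope ring_scope.

(* Declared at [numClosedFieldType] so that the topology and the normed module
   structure that MathComp-Analysis puts on any number field apply; derivatives
   over [Cplx R] are therefore complex derivatives. *)
Definition Cplx (R : realType) : numClosedFieldType := R[i].

(* e^(x + iy) = e^x (cos y + i sin y) *)
Definition expC (R : realType) (z : Cplx R) : Cplx R :=
  (expR (complex.Re z) * cos (complex.Im z)
    +i* (expR (complex.Re z) * sin (complex.Im z)))%C.

(* The paper's 1-based [a, b]: the ordinal i stands for the index i + 1. *)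
Definition interval_set (n a b : nat) : {set 'I_n} :=
  finset (fun i : 'I_n => (a <= i.+1 <= b)%N).

(* [enum] lists ordinals increasingly; the default value of [nth] is only
   reached when #|I| <> #|J|. *)
Definition minor (R : realType) (n : nat) (I J : {set 'I_n})
    (X : 'M[Cplx R]_n) : Cplx R :=
  \det (\matrix_(p < #|I|, q < #|I|)
          X (enum_val p) (nth (enum_val p) (enum J) q)).

Definition upper_minor (R : realType) (n l k : nat) (X : 'M[Cplx R]_n) :=
  minor (interval_set n 1 k) (interval_set n (l - k + 1) l) X.

Definition lower_minor (R : realType) (n l k : nat) (X : 'M[Cplx R]_n) :=
  minor (interval_set n (l - k + 1) l) (interval_set n 1 k) X.

Definition principal_minor (R : realType) (n l : nat) (X : 'M[Cplx R]_n) :=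
  minor (interval_set n 1 l) (interval_set n 1 l) X.

Definition singular_locus (R : realType) (n : nat) : set 'M[Cplx R]_n :=
  [set X | exists l k : nat,
     [/\ (1 <= k)%N, (k < l)%N, (l <= n)%N & lower_minor l k X = 0]].

Inductive GZ_hamiltonian (R : realType) (n : nat) :
    ('M[Cplx R]_n -> Cplx R) -> Prop :=
| GZ_quotient (l k : nat) : (1 <= k)%N -> (k < l)%N -> (l <= n)%N ->
    GZ_hamiltonian (fun X => upper_minor l k X / lower_minor l (l - k) X)
| GZ_principal (l : nat) : (1 <= l)%N -> (l <= n)%N ->
    GZ_hamiltonian (@principal_minor R n l).

(* Directional derivative along the elementary matrix E_kl. *)
Definition partial (R : realType) (n : nat) (k l : 'I_n)
    (f : 'M[Cplx R]_n -> Cplx R) (X : 'M[Cplx R]_n) : Cplx R :=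
  'D_(delta_mx k l) f X.

(* The bracket of pi_n, normalized by
   {x_ij, x_kl} = (sign(k - i) + sign(l - j)) x_il x_kj. *)
Definition poisson (R : realType) (n : nat)
    (f g : 'M[Cplx R]_n -> Cplx R) (X : 'M[Cplx R]_n) : Cplx R :=
  \sum_(i < n) \sum_(k < n) \sum_(j < n) \sum_(l < n)
    (sgz (k%:Z - i%:Z) + sgz (l%:Z - j%:Z))%:~R * X i l * X k j
      * (partial i j f X * partial k l g X).

Definition entry_fun (R : realType) (n : nat) (i j : 'I_n)
    (X : 'M[Cplx R]_n) : Cplx R := X i j.

Definition integral_curve (R : realType) (n : nat)
    (h : 'M[Cplx R]_n -> Cplx R) (U : set (Cplx R))
    (gamma : Cplx R -> 'M[Cplx R]_n) : Prop :=
  [/\ open U,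
      (forall t, U t -> ~ singular_locus (gamma t)) &
      (forall t, U t -> forall i j : 'I_n,
         is_derive t (1 : Cplx R) (fun s : Cplx R => gamma s i j)
           (poisson (entry_fun i j) h (gamma t)))].

Definition exp_quasipolynomial_entries (R : realType) (n : nat)
    (gamma : Cplx R -> 'M[Cplx R]_n) : Prop :=
  exists (N : nat) (b c d : 'M[Cplx R]_n) (cp dp alpha : 'I_N -> 'M[Cplx R]_n),
    (forall p i j, alpha p i j != 0) /\
    (forall t i j,
       gamma t i j =
         \sum_(p < N) (cp p i j + dp p i j * t) * expC (alpha p i j * t)
         + (b i j + c i j * t + d i j * t ^+ 2)).

(* Discrete in the sense of complex analysis (closed and discrete): no
   accumulation point anywhere in the plane. *)
Definition discrete_subset (R : realType) (A : set (Cplx R)) : Prop :=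
  limit_point A = set0.

(* Main.v *)
Require Import Defs.
From mathcomp Require Import all_boot all_order all_algebra.
From mathcomp Require Import complex.
From mathcomp Require Import all_classical all_reals all_analysis.
From mathcomp Require Import ring lra zify.

Set Implicit Arguments.
Unset Strict Implicit.
Unset Printing Implicit Defensive.

Import Order.TTheory GRing.Theory Num.Theory numFieldNormedType.Exports.

(* Write G for the transposed gradient of h, so that the Hamiltonian field is
   X' = R(XG) X - X R(GX) with R(A)_ij = sign(j - i) A_ij. The Hamiltonian depends only on
   the leading l x l block Y of X = [Y B; C D] and Poisson commutes with the entries of
   that block: Y is constant along the flow, and B' = M B, C' = C N, D' = - 2 C G B with
   constant M, N such that M^2 = N^2 = h^2 and N G = G M. Thus e^(tM) = c + s M, where
   c = cosh(ht) and s = sinh(ht)/h (c = 1 and s = t if h = 0), and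
   D = D_0 - 2 C_0 G (s c + s^2 M) B_0. Both kinds of Hamiltonian fit this pattern: for
   Delta_l one has M = N = - h; for u/v one has M = h - 2 Y G_1 and N = 2 G_2 Y - h, with
   G = G_1 - G_2 the contributions of u and v. Finally, a minor of the solution is a
   Laurent polynomial in e^(ht), or a polynomial in t if h = 0; it does not vanish at
   t = 0, so its zeros are isolated. *)

Local Open Scope ring_scope.

(** * Coordinate projections and triangular parts *)

Section Projections.
Variables (K : fieldType) (n : nat).
Implicit Types (I J : {set 'I_n}) (A B : 'M[K]_n).

(** Encodes an index set as a diagonal idempotent: blocks of X become products such as
    [projmx I *m X *m projmx J], all of size n, so no block casts arise. *)
Definition projmx I : 'M[K]_n := diag_mx (\row_i (i \in I)%:R).

(* A_ij -> sign(j - i) A_ij: strictly upper part minus strictly lower part. *)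
Definition sgnmx A : 'M[K]_n :=
  \matrix_(i, j) ((sgz (j%:Z - i%:Z))%:~R * A i j).

Lemma projmxMl I A i j : (projmx I *m A) i j = (i \in I)%:R * A i j.
Proof. by rewrite mul_diag_mx !mxE. Qed.

Lemma projmxMr I A i j : (A *m projmx I) i j = A i j * (j \in I)%:R.
Proof. by rewrite mul_mx_diag !mxE. Qed.

Lemma projmxE I i j : projmx I i j = ((i == j) && (i \in I))%:R.
Proof. by rewrite !mxE; case: eqP => [->|] //=; rewrite mulr0n. Qed.

Lemma projmxI I J : projmx I *m projmx J = projmx (I :&: J).
Proof.
apply/matrixP => i j; rewrite projmxMl !projmxE inE -natrM mulnb; congr (_%:R).
by case: eqP => [->|_] /=; rewrite ?andbF.
Qed.

Lemma projmx_idem I : projmx I *m projmx I = projmx I.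
Proof. by rewrite projmxI finset.setIid. Qed.

Lemma projmxU I J : [disjoint I & J] -> projmx (I :|: J) = projmx I + projmx J.
Proof.
move=> dIJ; apply/matrixP => i j; rewrite !mxE -mulrnDl inE; congr (_ *+ _).
have [/(disjointFr dIJ) -> /=|_ /=] := boolP (i \in I); first by rewrite addr0.
by rewrite add0r.
Qed.

Lemma projmx_disjoint I J : [disjoint I & J] -> projmx I *m projmx J = 0.
Proof.
rewrite projmxI -setI_eq0 => /eqP ->.
by apply/matrixP => i j; rewrite projmxE inE andbF mxE.
Qed.

Lemma sgnmxD A B : sgnmx (A + B) = sgnmx A + sgnmx B.
Proof. by apply/matrixP => i j; rewrite !mxE mulrDr. Qed.

Lemma sgnmxZ a A : sgnmx (a *: A) = a *: sgnmx A.
Proof. by apply/matrixP => i j; rewrite !mxE mulrCA. Qed.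

Lemma sgnmxN A : sgnmx (- A) = - sgnmx A.
Proof. by apply/matrixP => i j; rewrite !mxE mulrN. Qed.

Lemma sgnmx_proj I : sgnmx (projmx I) = 0.
Proof.
apply/matrixP => i j; rewrite !mxE; case: eqP => [->|_]; last by rewrite mulr0n mulr0.
by rewrite subrr sgz0 mul0r.
Qed.

Lemma sgnmx_upper I J A : {in I & J, forall i j : 'I_n, (i < j)%N} ->
  sgnmx (projmx I *m A *m projmx J) = projmx I *m A *m projmx J.
Proof.
move=> ltIJ; apply/matrixP => i j; rewrite mxE projmxMr projmxMl.
have [iI|] := boolP (i \in I); last by rewrite mul0r mul0r mulr0.
have [jJ|] := boolP (j \in J); last by rewrite !mulr0.
by rewrite gtr0_sgz ?mul1r// subr_gt0 ltz_nat ltIJ.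
Qed.

Lemma sgnmx_lower I J A : {in I & J, forall i j : 'I_n, (j < i)%N} ->
  sgnmx (projmx I *m A *m projmx J) = - (projmx I *m A *m projmx J).
Proof.
move=> ltIJ; apply/matrixP => i j; rewrite mxE [RHS]mxE projmxMr projmxMl.
have [iI|] := boolP (i \in I); last by rewrite mul0r mul0r mulr0 oppr0.
have [jJ|] := boolP (j \in J); last by rewrite !mulr0 oppr0.
by rewrite ltr0_sgz ?mulN1r// subr_lt0 ltz_nat ltIJ.
Qed.

End Projections.

(** * Gradients of minors *)

Section Adjugate.
Variables (K : fieldType) (m n : nat).
Implicit Types (X : 'M[K]_n).

(** In the expansion along row p the cofactors do not involve row p, so the determinant is affine in
    that entry. *)
Lemma det_delta (A : 'M[K]_m) a p q :
  \det (A + a *: delta_mx p q) = \det A + a * cofactor A p q.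
Proof.
rewrite (expand_det_row _ p) (expand_det_row A p).
have cof j : cofactor (A + a *: delta_mx p q) p j = cofactor A p j.
  rewrite /cofactor; congr (_ * \det _); apply/matrixP => i k; rewrite !mxE.
  by rewrite eq_sym (negPf (neq_lift _ _)) mulr0 addr0.
under eq_bigr do rewrite cof !mxE eqxx /= mulrDl.
rewrite big_split /=; congr (_ + _).
rewrite (bigD1 q) //= eqxx mulr1 big1 ?addr0// => j /negPf ->.
by rewrite mulr0 mul0r.
Qed.

(** Makes passing to a submatrix a product, [selmx f *m X *m (selmx g)^T], so that facts about the
    adjugate lift to n x n matrices. *)
Definition selmx (f : 'I_m -> 'I_n) : 'M[K]_(m, n) := \matrix_(p, i) (i == f p)%:R.

Lemma selmx_mul f (A : 'M[K]_n) : selmx f *m A = rowsub f A.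
Proof.
apply/matrixP => p j; rewrite !mxE (bigD1 (f p)) //= mxE eqxx mul1r big1 ?addr0//.
by move=> i /negPf ne; rewrite mxE ne mul0r.
Qed.

Lemma mul_selmxT g (A : 'M[K]_(m, n)) : A *m (selmx g)^T = colsub g A.
Proof.
apply/matrixP => p j; rewrite !mxE (bigD1 (g j)) //= !mxE eqxx mulr1 big1 ?addr0//.
by move=> i /negPf ne; rewrite !mxE ne mulr0.
Qed.

(* The transposed gradient of X |-> det (mxsub f g X); here and below a gradient G is
   stored so that G l k is the derivative along x_kl, hence dh = tr (G dX). *)
Definition adjgrad f g X : 'M[K]_n :=
  (selmx g)^T *m \adj (mxsub f g X) *m selmx f.

Lemma selmxK f : injective f -> selmx f *m (selmx f)^T = 1%:M.
Proof.
move=> fI; rewrite mul_selmxT; apply/matrixP => p q; rewrite !mxE.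
by rewrite (inj_eq fI) eq_sym.
Qed.

Lemma selmx_proj f (I : {set 'I_n}) : injective f -> (forall i, (i \in I) = (i \in codom f)) ->
  (selmx f)^T *m selmx f = projmx K I.
Proof.
move=> fI fE; apply/matrixP => i j; rewrite projmxE fE !mxE.
have [/codomP[p ->]|ni] := boolP (i \in codom f); last first.
  rewrite andbF big1// => p _; rewrite !mxE; case: eqP => [e|]; last by rewrite mul0r.
  by rewrite e codom_f in ni.
rewrite (bigD1 p) //= !mxE eqxx mul1r big1 ?addr0 ?andbT 1?eq_sym// => q /negPf ne.
by rewrite !mxE (inj_eq fI) eq_sym ne mul0r.
Qed.

Lemma mxsub_selmx f g X : mxsub f g X = selmx f *m X *m (selmx g)^T.
Proof. by rewrite selmx_mul mul_selmxT; apply/matrixP => i j; rewrite !mxE. Qed.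

Section Adjgrad.
Variables (f g : 'I_m -> 'I_n) (I J : {set 'I_n}) (X : 'M[K]_n).
Hypotheses (fI : injective f) (gI : injective g).
Hypotheses (fE : forall i, (i \in I) = (i \in codom f)).
Hypotheses (gE : forall i, (i \in J) = (i \in codom g)).
Let G := adjgrad f g X.
Let d := \det (mxsub f g X).

Lemma adjgrad_projr : G *m projmx K I = G.
Proof.
by rewrite -(selmx_proj fI fE) /G /adjgrad !mulmxA -(mulmxA _ (selmx f)) selmxK// mulmx1.
Qed.

Lemma adjgrad_projl : projmx K J *m G = G.
Proof.
by rewrite -(selmx_proj gI gE) /G /adjgrad !mulmxA -(mulmxA _ (selmx g)) selmxK// mulmx1.
Qed.

(** Cramer's rule A adj(A) = det(A) for the submatrix, carried back to size n. *)
Lemma proj_mul_adjgrad : projmx K I *m X *m G = d *: projmx K I.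
Proof.
rewrite -(selmx_proj fI fE).
transitivity ((selmx f)^T *m (mxsub f g X *m \adj (mxsub f g X)) *m selmx f).
  by rewrite [in X in X *m \adj _]mxsub_selmx !mulmxA.
by rewrite mul_mx_adj mul_mx_scalar -scalemxAl.
Qed.

Lemma adjgrad_mul_proj : G *m X *m projmx K J = d *: projmx K J.
Proof.
rewrite -(selmx_proj gI gE).
transitivity ((selmx g)^T *m (\adj (mxsub f g X) *m mxsub f g X) *m selmx g).
  by rewrite [in X in \adj _ *m X]mxsub_selmx !mulmxA.
by rewrite mul_adj_mx mul_mx_scalar -scalemxAl.
Qed.

(** If row k or column l is not selected, the submatrix does not change and the gradient entry
    vanishes; otherwise this is [det_delta], since f and g are injective. *)
Lemma det_mxsub_delta a k l :
  \det (mxsub f g (X + a *: delta_mx k l)) = d + a * G l k.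
Proof.
have Gz : (k \notin codom f) || (l \notin codom g) -> G l k = 0.
  rewrite -adjgrad_projr projmxMr -adjgrad_projl projmxMl fE gE.
  by case/orP => /negPf ->; rewrite ?mul0r ?mulr0 ?mul0r.
have [/codomP[p kE]|kN] := boolP (k \in codom f); last first.
  rewrite Gz ?kN// mulr0 addr0; congr (\det _); apply/matrixP => i j; rewrite !mxE.
  case: eqP => [e|_] /=; last by rewrite mulr0 addr0.
  by rewrite -e codom_f in kN.
have [/codomP[q lE]|lN] := boolP (l \in codom g); last first.
  rewrite Gz ?lN ?orbT// mulr0 addr0; congr (\det _); apply/matrixP => i j; rewrite !mxE.
  case: (g j =P l) => [e|_] /=; last by rewrite andbF mulr0 addr0.
  by rewrite -e codom_f in lN.
have -> : mxsub f g (X + a *: delta_mx k l) = mxsub f g X + a *: delta_mx p q.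
  by apply/matrixP => i j; rewrite !mxE kE lE (inj_eq fI) (inj_eq gI).
rewrite det_delta; congr (_ + _ * _).
rewrite /G /adjgrad !mxE (bigD1 p) //= !mxE kE eqxx mulr1.
rewrite [X in _ + X]big1 ?addr0; last first.
  by move=> i /negPf ne; rewrite !mxE (inj_eq fI) eq_sym ne mulr0.
rewrite (bigD1 q) //= !mxE lE eqxx mul1r big1 ?addr0// => i /negPf ne.
by rewrite !mxE (inj_eq gI) eq_sym ne mul0r.
Qed.

End Adjgrad.
End Adjugate.

(** * The block form of the flow *)

Section Flow.
Variables (K : fieldType) (n : nat) (L : {set 'I_n}).
Hypothesis ltL : {in L & ~: L, forall i j : 'I_n, (i < j)%N}.
Let E : 'M[K]_n := projmx K L.
Let F : 'M[K]_n := projmx K (~: L).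

(* The bracket {x_ij, h} of pi_n in matrix form, G being the transposed gradient of h. *)
Definition hamiltonian_field (X G : 'M[K]_n) : 'M[K]_n :=
  sgnmx (X *m G) *m X - X *m sgnmx (G *m X).

Lemma projmxC : E + F = 1%:M.
Proof.
rewrite /E /F -projmxU ?finset.setUCr; last by rewrite -setI_eq0 finset.setICr.
by apply/matrixP => i j; rewrite projmxE inE !mxE andbT.
Qed.

Let EE : E *m E = E. Proof. exact: projmx_idem. Qed.
Let FF : F *m F = F. Proof. exact: projmx_idem. Qed.
Let EF : E *m F = 0.
Proof. by apply: projmx_disjoint; rewrite -setI_eq0 finset.setICr. Qed.
Let FE : F *m E = 0.
Proof. by apply: projmx_disjoint; rewrite -setI_eq0 finset.setIC finset.setICr. Qed.

(* What the gradient G of a Hamiltonian depending only on the block Y must satisfy: Y is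
   then stationary, the blocks to its right and below it evolve by X' = M X and X' = X N,
   and fd_NG turns e^(tN) G e^(tM) into G e^(2tM), which fd_MM makes hyperbolic. *)
Record flow_data (h : K) (Y G M N : 'M[K]_n) : Prop := FlowData {
  fd_GE : G *m E = G;
  fd_EG : E *m G = G;
  fd_ME : M *m E = M;
  fd_EM : E *m M = M;
  fd_NE : N *m E = N;
  fd_EN : E *m N = N;
  fd_M : sgnmx (Y *m G) = M + Y *m G;
  fd_N : sgnmx (G *m Y) = - N - G *m Y;
  fd_Y : M *m Y + Y *m N + 2 *: (Y *m G *m Y) = 0;
  fd_MM : M *m M = h ^+ 2 *: E;
  fd_NN : N *m N = h ^+ 2 *: E;
  fd_NG : N *m G = G *m M }.

(** * Explicit solution of the block equations *)

Section Curve.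
Variables (h : K) (Y G M N : 'M[K]_n).
Hypothesis fd : flow_data h Y G M N.

(** Z G exceeds Y G by a strictly lower block and G Z exceeds G Y by a strictly upper one, so [fd_M]
    and [fd_N] determine both sign parts. *)
Lemma hamiltonian_field_block Z : E *m Z *m E = Y ->
  hamiltonian_field Z G = M *m Z *m F + F *m Z *m N - 2 *: (F *m Z *m G *m Z *m F).
Proof.
case: fd => GE EG ME EM NE EN HM HN HY _ _ _ ZY.
have YG : Y *m G = E *m Z *m G by rewrite -ZY -mulmxA EG.
have GY : G *m Y = G *m Z *m E by rewrite -ZY !mulmxA GE.
have ZG : Z *m G = Y *m G + F *m (Z *m G) *m E.
  by rewrite YG -[in F *m _ *m E]mulmxA -(mulmxA Z) GE -mulmxA -mulmxDl projmxC mul1mx.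
have GZ : G *m Z = G *m Y + E *m (G *m Z) *m F.
  by rewrite GY mulmxA EG -mulmxDr projmxC mulmx1.
have sZG : sgnmx (Z *m G) = M + Y *m G - F *m Z *m G.
  have low : {in ~: L & L, forall i j : 'I_n, (j < i)%N} by move=> i j iL jL; apply: ltL.
  rewrite ZG sgnmxD HM (sgnmx_lower _ low) -/E -/F; congr (_ - _).
  by rewrite -!mulmxA GE.
have sGZ : sgnmx (G *m Z) = - N - G *m Y + G *m Z *m F.
  by rewrite [in LHS]GZ sgnmxD HN (sgnmx_upper _ ltL) -/E -/F (mulmxA E) EG.
rewrite /hamiltonian_field sZG sGZ.
(* In the four blocks of W, the mixed ones EWF and FWE cancel, EWE = Y G Y is absorbed by [fd_Y],
   and FWF survives with factor -2. *)
set W := Z *m G *m Z.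
have MZ : M *m Z = M *m Y + M *m Z *m F.
  by rewrite -[in LHS](mulmx1 Z) -projmxC mulmxDr mulmxDr -ZY !mulmxA ME.
have ZN : Z *m N = Y *m N + F *m Z *m N.
  by rewrite -[in LHS](mul1mx Z) -projmxC !mulmxDl -ZY -[in E *m Z *m E *m N]mulmxA EN.
have W1 : Y *m G *m Z = E *m W *m E + E *m W *m F.
  by rewrite -mulmxDr projmxC mulmx1 YG /W !mulmxA.
have W2 : F *m Z *m G *m Z = F *m W *m E + F *m W *m F.
  by rewrite -mulmxDr projmxC mulmx1 /W !mulmxA.
have W3 : Z *m (G *m Y) = E *m W *m E + F *m W *m E.
  by rewrite -!mulmxDl projmxC mul1mx GY /W !mulmxA.
have W4 : Z *m (G *m Z *m F) = E *m W *m F + F *m W *m F.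
  by rewrite -!mulmxDl projmxC mul1mx /W !mulmxA.
have YGY : Y *m G *m Y = E *m W *m E.
  by rewrite YG -ZY /W !mulmxA -(mulmxA _ G E) GE.
rewrite !mulmxDl !mulmxDr !mulNmx !mulmxN.
have -> : F *m Z *m G *m Z *m F = F *m W *m F by rewrite /W !mulmxA.
rewrite W1 W2 W3 W4 [in LHS]MZ ZN.
rewrite YGY in HY.
move/(canRL (addrK _))/(canRL (addrK _)): HY => ->; rewrite sub0r.
move: (E *m W *m E) (E *m W *m F) (F *m W *m E) (F *m W *m F) (Y *m N).
move: (M *m Z *m F) (F *m Z *m N) => a1 a2 a3 a4 a5 a6 a7.
by apply/matrixP => i j; rewrite !mxE; ring.
Qed.

(* To be used with c = cosh (h t) and s = sinh (h t) / h (c = 1 and s = t if h = 0), so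
   that e^(tM) = c + s M on the block L; s c and s ^ 2 are primitives of the coefficients
   of e^(2tM). *)
Definition flow_curve (X : 'M[K]_n) (c s : K) : 'M[K]_n :=
  (E *m X *m E + F *m X *m F) + c *: (E *m X *m F + F *m X *m E)
  + s *: (M *m X *m F + F *m X *m N)
  - (2 * s * c) *: (F *m X *m G *m X *m F)
  - (2 * s ^+ 2) *: (F *m X *m G *m M *m X *m F).

(** The derivative of [flow_curve] under c' = h^2 s, s' = c. *)
Definition flow_velocity (X : 'M[K]_n) (c s : K) : 'M[K]_n :=
  (h ^+ 2 * s) *: (E *m X *m F + F *m X *m E)
  + c *: (M *m X *m F + F *m X *m N)
  - (2 * (c ^+ 2 + h ^+ 2 * s ^+ 2)) *: (F *m X *m G *m X *m F)
  - (4 * s * c) *: (F *m X *m G *m M *m X *m F).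

(** Separates constant matrices from the scalars c and s; differentiation, the quasipolynomial form
    and discreteness then become scalar questions. *)
Lemma flow_coefficients (X : 'M[K]_n) :
  exists K0 K1 K2 K3 K4 : 'M[K]_n, forall c s i j,
    flow_curve X c s i j =
      K0 i j + K1 i j * c + K2 i j * s + K3 i j * (s * c) + K4 i j * s ^+ 2 /\
    flow_velocity X c s i j = K1 i j * (h ^+ 2 * s) + K2 i j * c
      + K3 i j * (c * c + s * (h ^+ 2 * s)) + K4 i j * (2 * s * c).
Proof.
exists (E *m X *m E + F *m X *m F), (E *m X *m F + F *m X *m E),
  (M *m X *m F + F *m X *m N), (- 2 *: (F *m X *m G *m X *m F)),
  (- 2 *: (F *m X *m G *m M *m X *m F)) => c s i j; rewrite /flow_curve /flow_velocity.
move: (E *m X *m E + F *m X *m F) (E *m X *m F + F *m X *m E) => K0 K1.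
move: (M *m X *m F + F *m X *m N) (F *m X *m G *m X *m F) => K2 K3.
move: (F *m X *m G *m M *m X *m F) => K4.
by rewrite !mxE; split; ring.
Qed.

Variable X : 'M[K]_n.
Hypothesis XY : E *m X *m E = Y.

Lemma flow_curve_init : flow_curve X 1 0 = X.
Proof.
rewrite /flow_curve !(mulr0, mul0r, expr0n, scale0r, addr0, subr0, scale1r).
rewrite -[RHS]mulmx1 -[in RHS](mul1mx X) -projmxC !mulmxDl !mulmxDr.
move: (E *m X *m E) (F *m X *m F) (E *m X *m F) (F *m X *m E) => a1 a2 a3 a4.
by apply/matrixP => i j; rewrite !mxE; ring.
Qed.

Lemma flow_curveEr c s : E *m flow_curve X c s = Y + c *: (E *m X *m F) + s *: (M *m X *m F).
Proof.
case: fd => GE EG ME EM NE EN _ _ _ _ _ _.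
rewrite /flow_curve -XY !(mulmxDr, mulmxN) -!scalemxAr !(mulmxDr, mulmxN) !mulmxA EE EF EM.
by rewrite !mul0mx !addr0 !scaler0 !subr0.
Qed.

Lemma flow_curveEl c s : flow_curve X c s *m E = Y + c *: (F *m X *m E) + s *: (F *m X *m N).
Proof.
case: fd => GE EG ME EM NE EN _ _ _ _ _ _.
rewrite /flow_curve -XY !(mulmxDl, mulNmx) -!scalemxAl !(mulmxDl, mulNmx) -!mulmxA EE FE NE.
by rewrite !mulmx0 !addr0 !add0r !scaler0 !subr0.
Qed.

Lemma flow_curveE c s : E *m flow_curve X c s *m E = Y.
Proof.
case: fd => GE EG ME EM NE EN _ _ _ _ _ _.
rewrite flow_curveEr !mulmxDl -!scalemxAl -!mulmxA FE !mulmx0 !scaler0 !addr0.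
by rewrite -XY -!mulmxA EE.
Qed.

(** The curve keeps the block Y, so [hamiltonian_field_block] applies along it; [fd_MM] and [fd_NN]
    reduce the linear terms. *)
Lemma hamiltonian_field_flow_curve c s :
  hamiltonian_field (flow_curve X c s) G = flow_velocity X c s.
Proof.
have := fd; case=> GE EG ME EM NE EN _ _ _ MM NN NG.
set Z := flow_curve X c s.
have EZF : E *m Z *m F = c *: (E *m X *m F) + s *: (M *m X *m F).
  by rewrite flow_curveEr !mulmxDl -!scalemxAl -!mulmxA FF -XY -!mulmxA EF !mulmx0 add0r.
have FZE : F *m Z *m E = c *: (F *m X *m E) + s *: (F *m X *m N).
  by rewrite -mulmxA flow_curveEl !mulmxDr -!scalemxAr !mulmxA FF -XY !mulmxA FE !mul0mx add0r.
have MZF : M *m Z *m F = c *: (M *m X *m F) + (h ^+ 2 * s) *: (E *m X *m F).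
  rewrite -ME -2!mulmxA (mulmxA E) EZF mulmxDr -!scalemxAr !mulmxA ME MM.
  by rewrite -!scalemxAl scalerA [s * _]mulrC.
have FZN : F *m Z *m N = c *: (F *m X *m N) + (h ^+ 2 * s) *: (F *m X *m E).
  rewrite -EN mulmxA FZE mulmxDl -!scalemxAl -!mulmxA EN NN.
  by rewrite -!scalemxAr scalerA [s * _]mulrC.
have GMM : G *m M *m M = h ^+ 2 *: G by rewrite -mulmxA MM -scalemxAr GE.
(* The two cross terms in s c agree because N G = G M, and the s^2 term is N G M = G M^2 = h^2 G. *)
have FZGZF : F *m Z *m G *m Z *m F = (c ^+ 2 + h ^+ 2 * s ^+ 2) *: (F *m X *m G *m X *m F)
    + (2 * s * c) *: (F *m X *m G *m M *m X *m F).
  have -> : F *m Z *m G *m Z *m F = (F *m Z *m E) *m G *m (E *m Z *m F).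
    by rewrite -[in RHS](mulmxA _ E G) EG !mulmxA -[in RHS](mulmxA _ G E) GE.
  rewrite EZF FZE !mulmxDl !mulmxDr -!scalemxAl -!scalemxAr !scalerA.
  have -> : F *m X *m E *m G = F *m X *m G by rewrite -mulmxA EG.
  have -> : F *m X *m N *m G = F *m X *m G *m M by rewrite -mulmxA NG mulmxA.
  have GEX : F *m X *m G *m (E *m X *m F) = F *m X *m G *m X *m F.
    by rewrite !mulmxA -(mulmxA _ G E) GE.
  have -> : F *m X *m G *m M *m (E *m X *m F) = F *m X *m G *m M *m X *m F.
    by rewrite !mulmxA -(mulmxA _ M E) ME.
  have -> : F *m X *m G *m M *m (M *m X *m F) = h ^+ 2 *: (F *m X *m G *m X *m F).
    by rewrite !mulmxA -2!(mulmxA (F *m X)) GMM -scalemxAr -!scalemxAl.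
  rewrite GEX !mulmxA.
  move: (F *m X *m G *m X *m F) (F *m X *m G *m M *m X *m F) => a1 a2.
  by apply/matrixP => i j; rewrite !mxE; ring.
rewrite (hamiltonian_field_block (flow_curveE c s)) -/Z MZF FZN FZGZF /flow_velocity.
move: (F *m X *m G *m X *m F) (F *m X *m G *m M *m X *m F) (E *m X *m F) (F *m X *m E).
move: (M *m X *m F) (F *m X *m N) => a1 a2 a3 a4 a5 a6.
by apply/matrixP => i j; rewrite !mxE; ring.
Qed.

End Curve.
End Flow.

(** * Flow data for principal minors and for quotients of minors *)

Section FlowData.
Variables (K : fieldType) (n : nat).
Implicit Types (L I J : {set 'I_n}).

(** Y G and G Y are both the scalar h on the block, and the sign operator kills diagonal matrices;
    this forces M = N = - h there. *)
Lemma flow_data_principal L (h : K) (Y G : 'M[K]_n) :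
  projmx K L *m Y = Y -> G *m projmx K L = G -> projmx K L *m G = G ->
  Y *m G = h *: projmx K L -> G *m Y = h *: projmx K L ->
  flow_data L h Y G (- (h *: projmx K L)) (- (h *: projmx K L)).
Proof.
move=> EY GE EG YG GY; set E := projmx K L in EY GE EG YG GY *.
have EE : E *m E = E by exact: projmx_idem.
have YE : Y *m (h *: E) = h *: Y by rewrite -GY mulmxA YG -scalemxAl EY.
split; rewrite ?mulNmx ?mulmxN ?YG ?GY ?sgnmxZ ?sgnmx_proj -?scalemxAl ?EY ?EG ?GE //.
- by rewrite EE.
- by rewrite -scalemxAr EE.
- by rewrite EE.
- by rewrite -scalemxAr EE.
- by rewrite scaler0 addNr.
- by rewrite scaler0 opprK subrr.
- rewrite YE; move: (h *: Y) => a; apply/matrixP => i j; rewrite !mxE; ring.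
- by rewrite opprK -scalemxAr EE scalerA.
- by rewrite opprK -scalemxAr EE scalerA.
- by rewrite -scalemxAr GE.
Qed.

(* Here G1 and G2 are the gradient of u / v with respect to u and (up to sign) v, where
   the minors u, v sit in opposite corners (I1, J1), (I2, J2) of the block L. *)
Lemma flow_data_quotient L I1 I2 J1 J2 (h : K) (Y G1 G2 : 'M[K]_n) :
  [disjoint I1 & I2] -> [disjoint J1 & J2] -> I1 :|: I2 = L -> J1 :|: J2 = L ->
  {in I1 & I2, forall i j : 'I_n, (i < j)%N} ->
  {in J2 & J1, forall i j : 'I_n, (i < j)%N} ->
  projmx K L *m Y = Y -> Y *m projmx K L = Y ->
  G1 *m projmx K I1 = G1 -> projmx K J1 *m G1 = G1 ->
  G2 *m projmx K I2 = G2 -> projmx K J2 *m G2 = G2 ->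
  projmx K I1 *m Y *m G1 = h *: projmx K I1 -> G1 *m Y *m projmx K J1 = h *: projmx K J1 ->
  projmx K I2 *m Y *m G2 = h *: projmx K I2 -> G2 *m Y *m projmx K J2 = h *: projmx K J2 ->
  flow_data L h Y (G1 - G2) (h *: projmx K L - 2 *: (Y *m G1)) (2 *: (G2 *m Y) - h *: projmx K L).
Proof.
move=> dI dJ UI UJ ltI ltJ EY YE.
have eI := projmxU K dI; have eJ := projmxU K dJ; rewrite UI in eI; rewrite UJ in eJ.
have EE : projmx K L *m projmx K L = projmx K L by exact: projmx_idem.
have I12 := projmx_disjoint K dI; have J12 := projmx_disjoint K dJ.
have I21 : projmx K I2 *m projmx K I1 = 0 by apply: projmx_disjoint; rewrite disjoint_sym.
have J21 : projmx K J2 *m projmx K J1 = 0 by apply: projmx_disjoint; rewrite disjoint_sym.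
have s1 := sgnmx_lower (I := I2) (J := I1) (Y *m G1) (fun i j iI jJ => ltI j i jJ iI).
have s2 := sgnmx_upper (I := I1) (J := I2) (Y *m G2) ltI.
have t1 := sgnmx_lower (I := J1) (J := J2) (G1 *m Y) (fun i j iI jJ => ltJ j i jJ iI).
have t2 := sgnmx_upper (I := J2) (J := J1) (G2 *m Y) ltJ.
have z := (sgnmx_proj K I1, sgnmx_proj K I2, sgnmx_proj K J1, sgnmx_proj K J2).
move: s1 s2 t1 t2 z EY YE eI eJ EE I12 J12 I21 J21.
set E := projmx K L; set e1 := projmx K I1; set e2 := projmx K I2.
set f1 := projmx K J1; set f2 := projmx K J2.
move=> s1 s2 t1 t2 z EY YE eI eJ EE I12 J12 I21 J21 Ge1 fG1 Ge2 fG2 eY1 Yf1 eY2 Yf2.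
have G1E : G1 *m E = G1 by rewrite eI mulmxDr Ge1 -[in G1 *m e2]Ge1 -mulmxA I12 mulmx0 addr0.
have G2E : G2 *m E = G2 by rewrite eI mulmxDr Ge2 -[in G2 *m e1]Ge2 -mulmxA I21 mulmx0 add0r.
have EG1 : E *m G1 = G1 by rewrite eJ mulmxDl fG1 -[in f2 *m G1]fG1 mulmxA J21 mul0mx addr0.
have EG2 : E *m G2 = G2 by rewrite eJ mulmxDl fG2 -[in f1 *m G2]fG2 mulmxA J12 mul0mx add0r.
(* By Cramer, the rows in I1 give h; the remaining I2 x I1 block is strictly lower as I1 precedes
   I2. The next three products split likewise, with strictly upper, lower and upper remainders. *)
have YG1 : Y *m G1 = h *: e1 + e2 *m (Y *m G1) *m e1.
  by rewrite -[in LHS]EY eI !mulmxDl eY1 -!mulmxA Ge1.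
have YG2 : Y *m G2 = h *: e2 + e1 *m (Y *m G2) *m e2.
  by rewrite -[in LHS]EY eI !mulmxDl eY2 -!mulmxA Ge2 addrC.
have GY1 : G1 *m Y = h *: f1 + f1 *m (G1 *m Y) *m f2.
  by rewrite -[in LHS]YE eJ !mulmxDr !mulmxA Yf1 fG1.
have GY2 : G2 *m Y = h *: f2 + f2 *m (G2 *m Y) *m f1.
  by rewrite -[in LHS]YE eJ !mulmxDr !mulmxA Yf2 fG2 addrC.
have sYG1 : sgnmx (Y *m G1) = h *: e1 - Y *m G1.
  by rewrite [in LHS]YG1 sgnmxD sgnmxZ z scaler0 add0r s1 [in RHS]YG1 opprD addrA subrr add0r.
have sYG2 : sgnmx (Y *m G2) = Y *m G2 - h *: e2.
  by rewrite [in LHS]YG2 sgnmxD sgnmxZ z scaler0 add0r s2 [in RHS]YG2 addrAC subrr add0r.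
have sGY1 : sgnmx (G1 *m Y) = h *: f1 - G1 *m Y.
  by rewrite [in LHS]GY1 sgnmxD sgnmxZ z scaler0 add0r t1 [in RHS]GY1 opprD addrA subrr add0r.
have sGY2 : sgnmx (G2 *m Y) = G2 *m Y - h *: f2.
  by rewrite [in LHS]GY2 sgnmxD sgnmxZ z scaler0 add0r t2 [in RHS]GY2 addrAC subrr add0r.
(* Y G1 and G2 Y are thus h times idempotents when h is nonzero, and squaring h - 2 Y G1 or 2 G2 Y -
   h leaves h^2 on the block. *)
have g1 : G1 *m Y *m G1 = h *: G1 by rewrite -[in RHS]fG1 scalemxAl -Yf1 -[in RHS]mulmxA fG1.
have g2 : G2 *m Y *m G2 = h *: G2 by rewrite -[in RHS]fG2 scalemxAl -Yf2 -[in RHS]mulmxA fG2.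
have YGYG : Y *m G1 *m (Y *m G1) = h *: (Y *m G1) by rewrite -mulmxA (mulmxA G1) g1 scalemxAr.
have GYGY : G2 *m Y *m (G2 *m Y) = h *: (G2 *m Y) by rewrite mulmxA g2 scalemxAl.
split.
- by rewrite mulmxBl G1E G2E.
- by rewrite mulmxBr EG1 EG2.
- by rewrite mulmxBl -!scalemxAl EE -mulmxA G1E.
- by rewrite mulmxBr -!scalemxAr EE mulmxA EY.
- by rewrite mulmxBl -!scalemxAl EE -mulmxA YE.
- by rewrite mulmxBr -!scalemxAr EE mulmxA EG2.
- rewrite mulmxBr sgnmxD sgnmxN sYG1 sYG2 eI.
  move: (Y *m G1) (Y *m G2) => a1 a2; apply/matrixP => i j; rewrite !mxE; ring.
- rewrite mulmxBl sgnmxD sgnmxN sGY1 sGY2 eJ.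
  move: (G1 *m Y) (G2 *m Y) => a1 a2; apply/matrixP => i j; rewrite !mxE; ring.
- rewrite !(mulmxBl, mulmxBr) -!scalemxAl -!scalemxAr EY YE !mulmxA.
  move: (Y *m G1 *m Y) (Y *m G2 *m Y) => a1 a2; apply/matrixP => i j; rewrite !mxE; ring.
- rewrite !(mulmxBl, mulmxBr) -!scalemxAl -!scalemxAr EE YGYG mulmxA EY -mulmxA G1E.
  move: (Y *m G1) => a1; apply/matrixP => i j; rewrite !mxE; ring.
- rewrite !(mulmxBl, mulmxBr) -!scalemxAl -!scalemxAr EE GYGY mulmxA EG2 -mulmxA YE.
  move: (G2 *m Y) => a1; apply/matrixP => i j; rewrite !mxE; ring.
(* Both N G and G M equal 2 G2 Y G1 - h (G1 + G2). *)
- rewrite !(mulmxBl, mulmxBr) -!scalemxAl -!scalemxAr EG1 EG2 G1E G2E !mulmxA g1 g2.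
  move: (G2 *m Y *m G1) => a1; apply/matrixP => i j; rewrite !mxE; ring.
Qed.

End FlowData.

(** * Complex calculus *)

Section Analysis.
Local Open Scope classical_set_scope.

(** * Derivatives over a number field and isolated values *)

Section Calculus.
Variable K : numFieldType.

Lemma cvg_is_derive (V W : normedModType K) (f : V -> W) (x v : V) (d : W) :
  (fun h : K => h^-1 *: ((f \o shift x) (h *: v) - f x)) @ 0^' --> d ->
  is_derive x v f d.
Proof.
move=> cv; apply: DeriveDef; first by apply/cvg_ex; exists d.
exact: cvg_lim cv.
Qed.

(** The difference quotient is constant. This covers minors, which are affine along each elementary
    matrix. *)
Lemma is_derive_affine (V : normedModType K) (f : V -> K) (x v : V) (d : K) :
  (forall a, f (a *: v + x) = f x + a * d) -> is_derive x v f d.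
Proof.
move=> fE; apply: cvg_is_derive; apply: cvg_near_cst; near=> a.
by rewrite /= fE addrAC subrr add0r scalerA mulVf ?scale1r//; near: a; exact: nbhs_dnbhs_neq.
Unshelve. all: by end_near. Qed.

Lemma is_derive_comp1 (f g : K -> K) (x df dg : K) :
  is_derive x 1 f df -> is_derive (f x) 1 g dg -> is_derive x 1 (g \o f) (dg * df).
Proof.
move=> [/derivable1_diffP f' fE] [/derivable1_diffP g' gE].
have gf : differentiable (g \o f) x by exact: differentiable_comp.
apply: DeriveDef; first exact/derivable1_diffP.
rewrite deriveE// diff_comp// -fE -gE !deriveE//=.
by rewrite -[X in 'd g _ X]mulr1 [LHS]linearZ mulrC.
Qed.

Lemma near_neq (f : K -> K) (t r : K) : {for t, continuous f} -> f t != r ->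
  \forall s \near t, f s != r.
Proof.
move=> ct ftr; have e0 : 0 < `|f t - r| by rewrite normr_gt0 subr_eq0.
near=> s.
have : `|f t - f s| < `|f t - r|.
  by near: s; exact: (cvgrPdist_lt _ _).1 ct _ e0.
by apply: contraTneq => ->; rewrite ltxx.
Unshelve. all: by end_near. Qed.

(** If f t = r, a nearby s with f s = r would have difference quotient 0, yet that quotient is
    closer than |d| to d. If f t != r, continuity suffices. *)
Lemma derive_neq (f : K -> K) (t d r : K) : is_derive t 1 f d -> d != 0 ->
  \forall s \near t^', f s != r.
Proof.
case=> df dv d0.
have ct : {for t, continuous f} by exact/differentiable_continuous/derivable1_diffP.
have [ftr|ftr] := eqVneq (f t) r; last by apply: nbhs_dnbhs; exact: near_neq.
have cv : (fun h : K => h^-1 *: ((f \o shift t) (h *: 1) - f t)) @ 0^' --> d by rewrite -dv.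
have nd : 0 < `|d| by rewrite normr_gt0.
have [/= e e0 He] := (cvgrPdist_lt _ _).1 cv _ nd.
exists e => // s /= ts st; apply/eqP => fs.
have := He (s - t); rewrite /= sub0r opprB => /(_ ts).
by rewrite subr_eq0 => /(_ st); rewrite [_%:A]mulr1 subrK fs -ftr subrr scaler0 subr0 ltxx.
Qed.

End Calculus.

(** * The complex exponential and its derivative *)

Section ExpC.
Variable R : realType.
Notation C := (Cplx R).
Implicit Types (z : C) (x y : R).

Lemma expC0 : expC (0 : C) = 1.
Proof. by rewrite /expC /= expR0 cos0 sin0 mulr1 mulr0. Qed.

Lemma expCD z z' : expC (z + z') = expC z * expC z'.
Proof.
case: z z' => [x y] [x' y']; rewrite /expC /= expRD cosD sinD.
by apply/eqP; rewrite eq_complex /=; apply/andP; split; apply/eqP; ring.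
Qed.

Lemma expC_neq0 z : expC z != 0.
Proof.
apply/eqP => e; have := expCD z (- z).
by rewrite subrr expC0 e mul0r => /eqP; rewrite oner_eq0.
Qed.

Lemma expCN z : expC (- z) = (expC z)^-1.
Proof. by apply: (mulfI (expC_neq0 z)); rewrite -expCD subrr expC0 divff ?expC_neq0. Qed.

Lemma is_derive0_bound (f : R -> R) d : is_derive (0 : R) 1 f d ->
  forall r, 0 < r -> exists2 e : R, 0 < e & forall x, `|x| < e -> `|f x - f 0 - d * x| <= r * `|x|.
Proof.
case=> df dv r r0.
have cv : (fun h : R => h^-1 *: ((f \o shift 0) (h *: 1) - f 0)) @ 0^' --> d by rewrite -dv.
have [/= e e0 He] := (cvgrPdist_le _ _).1 cv _ r0.
exists e => // x xe; have [->|x0] := eqVneq x 0.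
  by rewrite subrr mulr0 subr0 normr0 mulr0.
have /(_ _)/(_ x0) := He x.
rewrite /= sub0r normrN => /(_ xe); rewrite addr0 [_%:A]mulr1 => b.
have -> : f x - f 0 - d * x = - ((d - x^-1 * (f x - f 0)) * x) by field.
by rewrite normrN normrM ler_pM2r ?normr_gt0.
Qed.

Lemma normC_leD z : `|z| <= (`|complex.Re z| + `|complex.Im z|)%:C%C.
Proof.
case: z => a b; rewrite normc_def lecR /= -[leRHS]ger0_norm ?addr_ge0// -sqrtr_sqr.
apply: ler_wsqrtr; rewrite -(real_normK (num_real a)) -(real_normK (num_real b)).
have := normr_ge0 a; have := normr_ge0 b; nra.
Qed.

Lemma normC_geIm z : (`|complex.Im z|%:C)%C <= `|z|.
Proof. by case: z => a b; rewrite normc_def lecR /= -sqrtr_sqr ler_wsqrtr // lerDr sqr_ge0. Qed.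

(** The first-order expansions of exp, cos and sin at 0 combine. With n = |z|, the factor 9 is 1 + 3
    + 3 + 2, from e^x - 1 - x, e^x (cos y - 1), e^x (sin y - y) and (e^x - 1) y. *)
Lemma expC_bound (r : R) : 0 < r -> exists2 e : R, 0 < e &
  forall z, `|z| < e%:C%C -> `|expC z - 1 - z| <= (9 * r)%:C%C * `|z|.
Proof.
move=> r0.
have [e1 e10 H1] := is_derive0_bound (is_derive_expR (0 : R)) r0.
have [e2 e20 H2] := is_derive0_bound (is_derive_expR (0 : R)) ltr01.
have [e3 e30 H3] := is_derive0_bound (is_derive_cos (0 : R)) r0.
have [e4 e40 H4] := is_derive0_bound (is_derive_sin (0 : R)) r0.
(* The bound 1 yields e^x <= 3; the bound r turns |e^x - 1| <= 2 |x| into 2 r. *)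
exists (Num.min (Num.min e1 e2) (Num.min (Num.min e3 e4) (Num.min r 1))).
  by rewrite !lt_min e10 e20 e30 e40 r0 ltr01.
case=> x y lte.
have := normc_ge_Re (x +i* y)%C; have := normC_geIm (x +i* y)%C.
have [n nE] : exists n, `|(x +i* y)%C : C| = (n%:C)%C by rewrite normc_def; eexists.
move: lte; rewrite nE ltcR !lecR /= !lt_min.
move=> /andP[/andP[n1 n2] /andP[/andP[n3 n4] /andP[nr n11]]] yn xn.
have {}H1 := H1 x (le_lt_trans xn n1); have {}H2 := H2 x (le_lt_trans xn n2).
have {}H3 := H3 y (le_lt_trans yn n3); have {}H4 := H4 y (le_lt_trans yn n4).
move: H1 H2 H3 H4; rewrite expR0 cos0 sin0 oppr0 !mul1r mul0r !subr0 addr0 => H1 H2 H3 H4.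
apply: (le_trans (normC_leD _)); rewrite -rmorphM lecR /=.
have n0 : 0 <= n by apply: le_trans xn.
have ex1 : `|expR x - 1| <= 2 * `|x|.
  by rewrite -[expR x - 1](subrK x) (le_trans (ler_normD _ _))// mulr_natl mulr2n lerD2r.
have ex3 : `|expR x| <= 3.
  rewrite -[expR x](subrK 1) (le_trans (ler_normD _ _))// normr1; lra.
have -> : expR x * cos y - 1 - x = (expR x - 1 - x) + expR x * (cos y - 1) by ring.
have -> : expR x * sin y - 0 - y = (expR x - 1) * y + expR x * (sin y - y) by ring.
have := ler_normD (expR x - 1 - x) (expR x * (cos y - 1)).
have := ler_normD ((expR x - 1) * y) (expR x * (sin y - y)).
rewrite !normrM => B1 B2.
have C1 : `|expR x| * `|cos y - 1| <= 3 * (r * n).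
  by apply: ler_pM => //; apply: (le_trans H3); rewrite ler_pM2l.
have C2 : `|expR x| * `|sin y - y| <= 3 * (r * n).
  by apply: ler_pM => //; apply: (le_trans H4); rewrite ler_pM2l.
have C3 : `|expR x - 1| * `|y| <= (2 * r) * n.
  apply: ler_pM => //; apply: (le_trans ex1); rewrite ler_pM2l//.
  exact: le_trans xn (ltW nr).
have C4 : r * `|x| <= r * n by rewrite ler_pM2l.
lra.
Qed.

Lemma is_derive_expC z : is_derive z (1 : C) (@expC R) (expC z).
Proof.
have cv : (fun h : C => h^-1 *: ((@expC R \o shift z) (h *: 1) - expC z)) @ 0^' --> expC z.
  (* The addition law reduces the claim to the limit of (e^h - 1) / h at 0. *)
  have -> : (fun h : C => h^-1 *: ((@expC R \o shift z) (h *: 1) - expC z)) =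
      (fun h : C => expC z * (h^-1 * (expC h - 1))).
    apply/funext => h; rewrite /= [_%:A]mulr1 expCD /GRing.scale /=; ring.
  rewrite -[X in _ --> X]mulr1; apply: cvgM; first exact: cvg_cst.
  apply/cvgrPdist_le => e e0.
  have [s eE] : exists s, e = (s%:C)%C by apply/complex_realP; rewrite gtr0_real.
  have s0 : 0 < s by move: e0; rewrite eE ltcR.
  have [d d0 Hd] := expC_bound (divr_gt0 s0 (ltr0n R 9)).
  exists (d%:C)%C => /=; first by rewrite ltcR.
  move=> h /=; rewrite sub0r normrN => hd h0.
  have := Hd h hd; have -> : 9 * (s / 9) = s by field.
  rewrite -eE => B.
  have -> : 1 - h^-1 * (expC h - 1) = - (h^-1 * (expC h - 1 - h)) by field.
  by rewrite normrN normrM normfV mulrC ler_pdivrMr ?normr_gt0.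
exact: cvg_is_derive.
Qed.

Lemma is_derive_expCM (a t : C) :
  is_derive t (1 : C) (fun s : C => expC (a * s)) (a * expC (a * t)).
Proof.
have d1 : is_derive t (1 : C) (fun s : C => a * s) a.
  by apply: is_derive_affine => h; rewrite [_%:A]mulr1 mulrDr addrC [a * h]mulrC.
have := is_derive_comp1 d1 (is_derive_expC (a * t)).
by rewrite mulrC.
Qed.

(** Over a closed field p splits, and [derive_neq] lets f avoid each of the finitely many roots on a
    punctured neighbourhood. *)
Lemma horner_isolated (f : C -> C) (t d : C) (p : {poly C}) : is_derive t (1 : C) f d -> d != 0 ->
  p != 0 -> \forall s \near t^', p.[f s] != 0.
Proof.
move=> df d0 p0; have [rs pE] := closed_field_poly_normal p.
have l0 : lead_coef p != 0 by rewrite lead_coef_eq0.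
have : \forall s \near t^', all (fun r => f s != r) rs.
  elim: rs {pE} => [|r rs IH]; first by near=> s.
  have := derive_neq r df d0; move: IH; apply: filter_app2.
  by near=> s => /= -> ->.
apply: filter_app; near=> s => /allP H.
rewrite pE hornerZ mulf_neq0// horner_prod prodf_seq_neq0; apply/allP => r rrs /=.
by rewrite hornerXsubC subr_eq0 H.
Unshelve. all: by end_near. Qed.

End ExpC.

End Analysis.

(** * The Gelfand-Zeitlin Hamiltonians *)

Section Minor.
Variables (R : realType) (n : nat).
Notation C := (Cplx R).
Implicit Types (I J L : {set 'I_n}) (X Z : 'M[C]_n).

(** The gradient of x_ij is an elementary matrix, which leaves a sum over k and l; its sign(k - i)
    part is R(XG) X and its sign(l - j) part is - X R(GX). *)
Lemma poisson_entry (h : 'M[C]_n -> C) X i j (G : 'M[C]_n) :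
  (forall k l, partial k l h X = G l k) ->
  poisson (entry_fun i j) h X = hamiltonian_field X G i j.
Proof.
move=> hG.
have dE a b : partial a b (entry_fun i j) X = ((a == i) && (b == j))%:R.
  have : is_derive X (delta_mx a b) (@entry_fun R n i j) (delta_mx a b i j).
    by apply: is_derive_affine => t; rewrite /entry_fun !mxE addrC.
  by move=> D; rewrite /partial derive_val mxE (eq_sym i) (eq_sym j).
rewrite /poisson (bigD1 i) //= [X in _ + X]big1 ?addr0; last first.
  move=> a /negPf ai; rewrite big1// => k _; rewrite big1// => b _.
  by rewrite big1// => l _; rewrite dE ai mul0r mulr0.
transitivity (\sum_(k < n) \sum_(l < n)
    (sgz (k%:Z - i%:Z) + sgz (l%:Z - j%:Z))%:~R * X i l * X k j * G l k).
  apply: eq_bigr => k _; rewrite (bigD1 j) //= [X in _ + X]big1 ?addr0; last first.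
    by move=> b /negPf bj; rewrite big1// => l _; rewrite dE bj andbF mul0r mulr0.
  by apply: eq_bigr => l _; rewrite dE !eqxx mul1r hG.
rewrite /hamiltonian_field !mxE.
transitivity (\sum_(k < n) sgnmx (X *m G) i k * X k j + \sum_(l < n) X i l * - sgnmx (G *m X) l j).
  transitivity (\sum_(k < n) \sum_(l < n)
     ((sgz (k%:Z - i%:Z))%:~R * (X i l * G l k) * X k j +
      X i l * ((sgz (l%:Z - j%:Z))%:~R * (G l k * X k j)))).
    by apply: eq_bigr => k _; apply: eq_bigr => l _; rewrite rmorphD /=; ring.
  under eq_bigr do rewrite big_split /=.
  rewrite big_split /=; congr (_ + _).
    by apply: eq_bigr => k _; rewrite !mxE mulr_sumr mulr_suml.
  rewrite exchange_big /=; apply: eq_bigr => l _; rewrite !mxE -mulNr -rmorphN /= -sgzN opprB.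
  by rewrite !mulr_sumr.
congr (_ + _); rewrite -sumrN; apply: eq_bigr => l _; by rewrite mulrN.
Qed.

(** * Minors and their gradients through row and column selections *)

Section Select.
Variables (I J : {set 'I_n}) (cIJ : #|I| = #|J|).

Definition rowsel (p : 'I_#|I|) : 'I_n := enum_val p.
Definition colsel (p : 'I_#|I|) : 'I_n := enum_val (cast_ord cIJ p).

(** Equal cardinalities keep [nth] inside [enum J], so its default value never enters. *)
Lemma minorE X : minor I J X = \det (mxsub rowsel colsel X).
Proof.
congr (\det _); apply/matrixP => p q; rewrite !mxE /colsel /enum_val; congr (X _ _).
by apply: set_nth_default; rewrite -cardE -cIJ.
Qed.

Lemma rowsel_inj : injective rowsel. Proof. exact: enum_val_inj. Qed.

Lemma colsel_inj : injective colsel.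
Proof. by move=> p q /enum_val_inj /cast_ord_inj. Qed.

Lemma mem_rowsel i : (i \in I) = (i \in codom rowsel).
Proof.
apply/idP/codomP => [iI|[p ->]]; last exact: enum_valP.
by exists (enum_rank_in iI i); rewrite /rowsel enum_rankK_in.
Qed.

Lemma mem_colsel i : (i \in J) = (i \in codom colsel).
Proof.
apply/idP/codomP => [iJ|[p ->]]; last exact: enum_valP.
by exists (cast_ord (esym cIJ) (enum_rank_in iJ i)); rewrite /colsel cast_ordKV enum_rankK_in.
Qed.

Definition gradmx X : 'M[C]_n := adjgrad rowsel colsel X.

Lemma is_derive_minor X k l : is_derive X (delta_mx k l) (@minor R n I J) (gradmx X l k).
Proof.
apply: is_derive_affine => a; rewrite addrC !minorE.
exact: det_mxsub_delta rowsel_inj colsel_inj mem_rowsel mem_colsel _ _ _.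
Qed.

Lemma mxsub_proj L X : I \subset L -> J \subset L ->
  mxsub rowsel colsel (projmx _ L *m X *m projmx _ L) = mxsub rowsel colsel X.
Proof.
move=> /fintype.subsetP IL /fintype.subsetP JL; apply/matrixP => p q.
rewrite [LHS]mxE [RHS]mxE projmxMr projmxMl IL ?enum_valP// JL ?enum_valP//.
by rewrite mul1r mulr1.
Qed.

(** The gradient of a minor inside [L] sees only that block, so it is constant wherever the block
    is. *)
Lemma gradmx_proj L X : I \subset L -> J \subset L ->
  gradmx (projmx _ L *m X *m projmx _ L) = gradmx X.
Proof. by move=> IL JL; rewrite /gradmx /adjgrad mxsub_proj. Qed.

Lemma minor_proj L X : I \subset L -> J \subset L ->
  minor I J (projmx _ L *m X *m projmx _ L) = minor I J X.
Proof. by move=> IL JL; rewrite !minorE mxsub_proj. Qed.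

Lemma gradmx_projr X : gradmx X *m projmx _ I = gradmx X.
Proof. exact: adjgrad_projr rowsel_inj mem_rowsel. Qed.

Lemma gradmx_projl X : projmx _ J *m gradmx X = gradmx X.
Proof. exact: adjgrad_projl colsel_inj mem_colsel. Qed.

Lemma proj_mul_gradmx X : projmx _ I *m X *m gradmx X = minor I J X *: projmx _ I.
Proof. by rewrite minorE; exact: proj_mul_adjgrad rowsel_inj mem_rowsel. Qed.

Lemma gradmx_mul_proj X : gradmx X *m X *m projmx _ J = minor I J X *: projmx _ J.
Proof. by rewrite minorE; exact: adjgrad_mul_proj colsel_inj mem_colsel. Qed.

End Select.

(** * Interval index sets *)

Lemma mem_interval a b (i : 'I_n) : (i \in interval_set n a b) = (a <= i.+1 <= b)%N.
Proof. by rewrite inE. Qed.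

Lemma card_interval_shift k l : (k <= l <= n)%N ->
  #|interval_set n 1 k| = #|interval_set n (l - k + 1) l|.
Proof.
case/andP=> kl ln.
have lt (i : 'I_n) : (i < k)%N -> (i + (l - k) < n)%N by lia.
(* Shift by l - k, continued by the identity beyond k so that it is total on ['I_n]. *)
pose f (i : 'I_n) := if (i < k)%N =P true is ReflectT e then Ordinal (lt i e) else i.
have fE (i : 'I_n) : (i < k)%N -> f i = (i + (l - k))%N :> nat by move=> ik; rewrite /f; case: eqP.
rewrite -(card_in_imset (f := f) (D := interval_set n 1 k)); last first.
  move=> i j; rewrite !inE => /andP[_ ik] /andP[_ jk] /(congr1 val) /=.
  by rewrite !fE// => /addIn/val_inj.
apply: eq_card => i; rewrite !inE; apply/imsetP/idP => [[j]|ilk].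
  by rewrite inE => jk ->; rewrite fE; lia.
have jn : (i - (l - k) < n)%N by lia.
exists (Ordinal jn); first by rewrite inE /=; lia.
by apply: val_inj; rewrite /= fE /=; lia.
Qed.

Lemma intervalS a b c d : (c <= a)%N -> (b <= d)%N ->
  interval_set n a b \subset interval_set n c d.
Proof. by move=> ca bd; apply/fintype.subsetP => i; rewrite !mem_interval; lia. Qed.

Lemma interval_disjoint a b c d : (b < c)%N ->
  [disjoint interval_set n a b & interval_set n c d].
Proof.
move=> bc; rewrite disjoint_subset; apply/fintype.subsetP => i.
by rewrite !inE; lia.
Qed.

Lemma intervalU k l : (k <= l)%N ->
  interval_set n 1 k :|: interval_set n (k + 1) l = interval_set n 1 l.
Proof. by move=> kl; apply/setP => i; rewrite inE !mem_interval; lia. Qed.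

Lemma interval_ltn a b c d : (b < c)%N ->
  {in interval_set n a b & interval_set n c d, forall i j : 'I_n, (i < j)%N}.
Proof. by move=> bc i j; rewrite !mem_interval; lia. Qed.

(** Here L = [1, l], and h0 is the value of the Hamiltonian at X0. The gradient is claimed at every
    Z sharing the block of X0, hence along the whole flow. *)
Lemma GZ_flow_data h X0 : GZ_hamiltonian h -> ~ singular_locus X0 ->
  exists L (h0 : C) (G M N : 'M[C]_n),
  let Y := projmx _ L *m X0 *m projmx _ L in
  [/\ {in L & ~: L, forall i j : 'I_n, (i < j)%N},
      flow_data L h0 Y G M N &
      forall Z, projmx _ L *m Z *m projmx _ L = Y -> forall k l, partial k l h Z = G l k].
Proof.
case=> [l k k1 kl ln|l l1 ln] nX0; last first.
  set L := interval_set n 1 l; pose cL := erefl #|L|.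
  have sLL : L \subset L by [].
  exists L, (minor L L X0), (gradmx cL X0), (- (minor L L X0 *: projmx _ L)),
    (- (minor L L X0 *: projmx _ L)) => Y.
  have EE : projmx C L *m projmx C L = projmx C L by exact: projmx_idem.
  have GY : gradmx cL X0 = gradmx cL Y by rewrite gradmx_proj.
  have mY : minor L L X0 = minor L L Y by rewrite minor_proj.
  have EY : projmx C L *m Y = Y by rewrite /Y !mulmxA EE.
  have YE : Y *m projmx C L = Y by rewrite /Y -!mulmxA EE.
  clearbody Y; split.
  - by move=> i j; rewrite !inE; lia.
  - apply: flow_data_principal.
    + exact: EY.
    + exact: gradmx_projr.
    + exact: gradmx_projl.
    + by rewrite GY mY -(proj_mul_gradmx cL) EY.
    + by rewrite GY mY -(gradmx_mul_proj cL) -mulmxA YE.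
  - move=> Z ZY i j; rewrite /partial.
    have D := is_derive_minor cL Z i j.
    by rewrite /principal_minor derive_val -(gradmx_proj _ Z sLL sLL) ZY -GY.
set L := interval_set n 1 l.
(* As l - (l - k) = k, the denominator has rows [k + 1, l] and columns [1, l - k], complementary in
   [1, l] to those of the numerator. *)
set I1 := interval_set n 1 k; set I2 := interval_set n (k + 1) l.
set J1 := interval_set n (l - k + 1) l; set J2 := interval_set n 1 (l - k).
have c1 : #|I1| = #|J1| by apply: card_interval_shift; lia.
have lk : (l - (l - k) = k)%N by lia.
have c2 : #|I2| = #|J2|.
  by rewrite /J2 (@card_interval_shift _ l) ?lk//; lia.
have sI1 : I1 \subset L by apply: intervalS; lia.
have sI2 : I2 \subset L by apply: intervalS; lia.
have sJ1 : J1 \subset L by apply: intervalS; lia.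
have sJ2 : J2 \subset L by apply: intervalS; lia.
pose u := minor I1 J1 X0; pose v := minor I2 J2 X0.
have v0 : v != 0.
  apply/eqP => v0; apply: nX0; exists l, (l - k)%N; split; [lia|lia|lia|].
  by rewrite /lower_minor lk.
(* The quotient rule d(u/v) = du / v - (u / v^2) dv; with these factors Cramer's rule gives the same
   scalar u / v for both terms. *)
pose G1 := v^-1 *: gradmx c1 X0; pose G2 := (u / v ^+ 2) *: gradmx c2 X0.
pose Y := projmx C L *m X0 *m projmx C L.
exists L, (u / v), (G1 - G2), ((u / v) *: projmx _ L - 2 *: (Y *m G1)),
  (2 *: (G2 *m Y) - (u / v) *: projmx _ L); rewrite -/Y; cbv zeta.
have EE : projmx C L *m projmx C L = projmx C L by exact: projmx_idem.
have GY1 : gradmx c1 X0 = gradmx c1 Y by rewrite gradmx_proj.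
have GY2 : gradmx c2 X0 = gradmx c2 Y by rewrite gradmx_proj.
have uY : u = minor I1 J1 Y by rewrite minor_proj.
have vY : v = minor I2 J2 Y by rewrite minor_proj.
have EY : projmx C L *m Y = Y by rewrite /Y !mulmxA EE.
have YE : Y *m projmx C L = Y by rewrite /Y -!mulmxA EE.
clearbody Y u v; split.
- by move=> i j; rewrite !inE; lia.
- apply: (@flow_data_quotient _ _ _ I1 I2 J1 J2).
  + by apply: interval_disjoint; lia.
  + by rewrite disjoint_sym; apply: interval_disjoint; lia.
  + by apply: intervalU; lia.
  + by rewrite finset.setUC; apply: intervalU; lia.
  + by apply: interval_ltn; lia.
  + by apply: interval_ltn; lia.
  + exact: EY.
  + exact: YE.
  + by rewrite -scalemxAl gradmx_projr.
  + by rewrite -scalemxAr gradmx_projl.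
  + by rewrite -scalemxAl gradmx_projr.
  + by rewrite -scalemxAr gradmx_projl.
  + by rewrite -scalemxAr GY1 proj_mul_gradmx scalerA -uY mulrC.
  + by rewrite -!scalemxAl GY1 gradmx_mul_proj scalerA -uY mulrC.
  + by rewrite -scalemxAr GY2 proj_mul_gradmx scalerA -vY expr2 invfM mulrA mulfVK.
  + by rewrite -!scalemxAl GY2 gradmx_mul_proj scalerA -vY expr2 invfM mulrA mulfVK.
- move=> Z ZY i j; rewrite /partial.
  have D1 := is_derive_minor c1 Z i j.
  have D2 := is_derive_minor c2 Z i j.
  have uZ : minor I1 J1 Z = u by rewrite uY -ZY minor_proj.
  have vZ : minor I2 J2 Z = v by rewrite vY -ZY minor_proj.
  have -> : (fun X : 'M[C]_n => upper_minor l k X / lower_minor l (l - k) X) =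
      (@minor R n I1 J1) * (fun X => (minor I2 J2 X)^-1).
    by apply/funext => X; rewrite /lower_minor lk.
  have v0Z : minor I2 J2 Z != 0 by rewrite vZ.
  have d1 : derivable (@minor R n I1 J1) Z (delta_mx i j) by exact: ex_derive.
  have d2 : derivable (@minor R n I2 J2) Z (delta_mx i j) by exact: ex_derive.
  rewrite (deriveM d1 (derivableV v0Z d2)) (deriveV v0Z d2) !derive_val vZ uZ.
  rewrite -(gradmx_proj c1 Z sI1 sJ1) -(gradmx_proj c2 Z sI2 sJ2) ZY -GY1 -GY2 /G1 /G2.
  move: (gradmx c1 X0) (gradmx c2 X0) => g1 g2; rewrite !mxE.
  by rewrite /GRing.scale /=; field.
Qed.

End Minor.

Local Open Scope classical_set_scope.

Lemma is_derive_quadratic (K : numFieldType) (c s : K -> K) (t dc ds a0 a1 a2 a3 a4 : K) :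
  is_derive t 1 c dc -> is_derive t 1 s ds ->
  is_derive t 1 (fun x => a0 + a1 * c x + a2 * s x + a3 * (s x * c x) + a4 * s x ^+ 2)
    (a1 * dc + a2 * ds + a3 * (ds * c t + s t * dc) + a4 * (2 * s t * ds)).
Proof.
move=> Dc Ds.
have D := is_deriveD (is_deriveD (is_deriveD (is_deriveD (is_derive_cst a0 t 1)
   (is_deriveZ a1 Dc)) (is_deriveZ a2 Ds)) (is_deriveZ a3 (is_deriveM Ds Dc)))
   (is_deriveZ a4 (is_deriveX 2 Ds)).
apply: (is_derive_eq D); rewrite /GRing.scale /=; ring.
Qed.

(** * Solution curves *)

Section Main.
Variables (R : realType) (n : nat).
Notation C := (Cplx R).

(* Each lower-left minor becomes a nowhere vanishing factor times Q(phi t) for a nonzero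
   polynomial Q, and phi takes each of the finitely many roots of Q at isolated points. *)
Lemma discrete_singular_preimage (gamma : C -> 'M[C]_n) (a phi dphi : C -> C)
    (P : 'M[{poly C}]_n) :
  (forall t, a t != 0) -> (forall t, dphi t != 0) ->
  (forall t : C, is_derive t (1 : C) phi (dphi t)) ->
  (forall t i j, gamma t i j = a t * (P i j).[phi t]) ->
  ~ singular_locus (gamma 0) ->
  discrete_subset (gamma @^-1` @singular_locus R n).
Proof.
move=> a0 dphi0 Dphi gammaE nsing; apply/seteqP; split=> // t limt.
(* Pairs (l, k) are taken in a finite type so that [filter_forall] can intersect the
   neighbourhoods. *)
have near_minor (lk : 'I_n.+1 * 'I_n.+1) :
    \forall s \near t^', (1 <= lk.2 < lk.1)%N -> lower_minor lk.1 lk.2 (gamma s) != 0.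
  case: lk => l k /=; have [/andP[k1 kl]|_] := boolP (1 <= k < l)%N; last by near=> s.
  have ln : (l <= n)%N by rewrite -ltnS.
  have e : #|interval_set n (l - k + 1) l| = #|interval_set n 1 k|.
    by rewrite -(@card_interval_shift n k l)// (ltnW kl).
  pose Q := \det (mxsub (@rowsel n _) (colsel e) P).
  have mE s : lower_minor l k (gamma s) = a s ^+ #|interval_set n (l - k + 1) l| * Q.[phi s].
    rewrite /lower_minor (minorE e) -[_.[_]]/(horner_eval (phi s) Q) -det_map_mx -detZ.
    congr (\det _).
    by apply/matrixP => i j; rewrite !mxE gammaE.
  (* If Q were 0, this minor would vanish at t = 0, against regularity of the initial point. *)
  have Q0 : Q != 0.
    apply/eqP => Q0; apply: nsing; exists l, k; split => //.
    by rewrite mE Q0 horner0 mulr0.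
  have := horner_isolated (Dphi t) (dphi0 t) Q0.
  by apply: filterS => s Qs _; rewrite mE mulf_neq0// expf_neq0.
have : \forall s \near t^', forall lk : 'I_n.+1 * 'I_n.+1,
    (1 <= lk.2 < lk.1)%N -> lower_minor lk.1 lk.2 (gamma s) != 0.
  exact: filter_forall.
move=> /limt[y [yt [l [k [k1 kl ln yE]]]] /(_ yt)].
have kn : (k < n.+1)%N by lia.
move=> /(_ (Ordinal (ln : (l < n.+1)%N), Ordinal kn)) /=.
by rewrite k1 kl yE eqxx => /(_ isT).
Unshelve. all: by end_near. Qed.

Lemma discrete_open (A : set C) : discrete_subset A -> open (~` A).
Proof.
move=> A0; rewrite openC /closed closure_isolated_limit_point A0 setU0.
exact: isolatedS.
Qed.

Lemma flow_integral_curve (L : {set 'I_n}) (h : 'M[C]_n -> C) (h0 : C) (Y G M N X0 : 'M[C]_n)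
    (c s : C -> C) :
  {in L & (~: L)%SET, forall i j : 'I_n, (i < j)%N} ->
  flow_data L h0 Y G M N ->
  (forall Z, projmx _ L *m Z *m projmx _ L = Y -> forall k l, partial k l h Z = G l k) ->
  projmx _ L *m X0 *m projmx _ L = Y ->
  (forall t : C, is_derive t (1 : C) c (h0 ^+ 2 * s t)) ->
  (forall t : C, is_derive t (1 : C) s (c t)) ->
  forall (t : C) i j, is_derive t (1 : C) (fun x : C => flow_curve L G M N X0 (c x) (s x) i j)
    (poisson (entry_fun i j) h (flow_curve L G M N X0 (c t) (s t))).
Proof.
move=> ltL fd gradE X0Y Dc Ds t i j.
rewrite (@poisson_entry _ _ _ _ _ _ G); last first.
  by apply: gradE; apply: (flow_curveE fd X0Y).
have [K0 [K1 [K2 [K3 [K4 KE]]]]] := flow_coefficients L h0 G M N X0.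
rewrite (hamiltonian_field_flow_curve ltL fd X0Y) (KE _ _ _ _).2.
under eq_fun do rewrite (KE _ _ _ _).1.
exact: is_derive_quadratic.
Qed.

(** The common part of the cases h0 = 0 and h0 != 0. Writing 1, c, s, s c and s^2 as polynomials in
    phi times one factor a gives every entry that shape. *)
Lemma flow_curve_solution (L : {set 'I_n}) (h : 'M[C]_n -> C) (h0 : C) (G M N X0 : 'M[C]_n)
    (c s a phi dphi : C -> C) (p0 pc ps psc pss : {poly C}) :
  {in L & (~: L)%SET, forall i j : 'I_n, (i < j)%N} ->
  flow_data L h0 (projmx _ L *m X0 *m projmx _ L) G M N ->
  (forall Z, projmx _ L *m Z *m projmx _ L = projmx _ L *m X0 *m projmx _ L ->
    forall k l, partial k l h Z = G l k) ->
  (forall t : C, is_derive t (1 : C) c (h0 ^+ 2 * s t)) ->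
  (forall t : C, is_derive t (1 : C) s (c t)) -> c 0 = 1 -> s 0 = 0 ->
  (forall t, a t != 0) -> (forall t, dphi t != 0) ->
  (forall t : C, is_derive t (1 : C) phi (dphi t)) ->
  (forall t, [/\ 1 = a t * p0.[phi t], c t = a t * pc.[phi t], s t = a t * ps.[phi t],
     s t * c t = a t * psc.[phi t] & s t ^+ 2 = a t * pss.[phi t]]) ->
  ~ singular_locus X0 ->
  (forall K0 K1 K2 K3 K4 : 'M[C]_n, exp_quasipolynomial_entries (fun t => \matrix_(i, j)
     (K0 i j + K1 i j * c t + K2 i j * s t + K3 i j * (s t * c t) + K4 i j * s t ^+ 2))) ->
  exists gamma : C -> 'M[C]_n,
    exp_quasipolynomial_entries gamma /\
    discrete_subset (gamma @^-1` @singular_locus R n) /\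
    integral_curve h (~` (gamma @^-1` @singular_locus R n)) gamma /\
    gamma 0 = X0.
Proof.
move=> ltL fd gradE Dc Ds c0 s0 a0 dphi0 Dphi polyE nsing expE.
pose gamma t := flow_curve L G M N X0 (c t) (s t).
have gamma0 : gamma 0 = X0 by rewrite /gamma c0 s0; exact: flow_curve_init.
have [K0 [K1 [K2 [K3 [K4 KE]]]]] := flow_coefficients L h0 G M N X0.
have disc : discrete_subset (gamma @^-1` @singular_locus R n).
  apply: (@discrete_singular_preimage gamma a phi dphi (\matrix_(i, j)
    ((K0 i j)%:P * p0 + (K1 i j)%:P * pc + (K2 i j)%:P * ps + (K3 i j)%:P * psc
     + (K4 i j)%:P * pss))) => //; last by rewrite gamma0.
  move=> t i j; rewrite [in RHS]mxE !hornerE /gamma (KE _ _ _ _).1.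
  have [e0 ec es esc ess] := polyE t.
  by rewrite esc ess ec es -[K0 i j in LHS]mulr1 e0; ring.
exists gamma; split; [|split=> //; split=> //].
  have -> : gamma = (fun t => \matrix_(i, j)
     (K0 i j + K1 i j * c t + K2 i j * s t + K3 i j * (s t * c t) + K4 i j * s t ^+ 2)).
    by apply/funext => t; apply/matrixP => i j; rewrite /gamma (KE _ _ _ _).1 mxE.
  exact: expE.
split=> //; first exact: discrete_open.
by move=> t _ i j; apply: (flow_integral_curve ltL fd gradE erefl Dc Ds).
Qed.

Lemma linear_quasipolynomial (K0 K1 K2 K3 K4 : 'M[C]_n) :
  exp_quasipolynomial_entries (fun t : C => \matrix_(i, j)
     (K0 i j + K1 i j * 1 + K2 i j * t + K3 i j * (t * 1) + K4 i j * t ^+ 2)).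
Proof.
exists 0%N, (K0 + K1), (K2 + K3), K4, (fun=> 0), (fun=> 0), (fun=> 0); split; first by case.
by move=> t i j; rewrite big_ord0 !mxE; ring.
Qed.

(** * The scalars c and s for nonzero h0 *)

Section Hyperbolic.
Variables (h0 : C) (h0N : h0 != 0).

Definition coshC (t : C) : C := (expC (h0 * t) + expC (- h0 * t)) / 2.
(* Normalized as sinh (h0 t) / h0. *)
Definition sinhC (t : C) : C := (expC (h0 * t) - expC (- h0 * t)) / (2 * h0).

Lemma is_derive_coshC (t : C) : is_derive t (1 : C) coshC (h0 ^+ 2 * sinhC t).
Proof.
have D := is_derive_quadratic 0 2^-1 2^-1 0 0 (is_derive_expCM h0 t) (is_derive_expCM (- h0) t).
have -> : coshC = (fun x => 0 + 2^-1 * expC (h0 * x) + 2^-1 * expC (- h0 * x) +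
  0 * (expC (- h0 * x) * expC (h0 * x)) + 0 * expC (- h0 * x) ^+ 2).
  by apply/funext => x; rewrite /coshC; field.
by apply: (is_derive_eq D); rewrite /sinhC; field.
Qed.

Lemma is_derive_sinhC (t : C) : is_derive t (1 : C) sinhC (coshC t).
Proof.
have D := is_derive_quadratic 0 (2 * h0)^-1 (- (2 * h0)^-1) 0 0
  (is_derive_expCM h0 t) (is_derive_expCM (- h0) t).
have -> : sinhC = (fun x => 0 + (2 * h0)^-1 * expC (h0 * x) + (- (2 * h0)^-1) * expC (- h0 * x) +
  0 * (expC (- h0 * x) * expC (h0 * x)) + 0 * expC (- h0 * x) ^+ 2).
  by apply/funext => x; rewrite /sinhC; field.
by apply: (is_derive_eq D); rewrite /coshC; field.
Qed.

Lemma hyperbolic_quasipolynomial (K0 K1 K2 K3 K4 : 'M[C]_n) :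
  exp_quasipolynomial_entries (fun t : C => \matrix_(i, j)
     (K0 i j + K1 i j * coshC t + K2 i j * sinhC t + K3 i j * (sinhC t * coshC t)
      + K4 i j * sinhC t ^+ 2)).
Proof.
(* With w = e^(h0 t): s c = (w^2 - w^-2) / (4 h0) and s^2 = (w^2 - 2 + w^-2) / (4 h0^2). The -2
   moves into the constant term; the exponents are those of w, w^-1, w^2, w^-2. *)
pose cp := [:: 2^-1 *: K1 + (2 * h0)^-1 *: K2; 2^-1 *: K1 - (2 * h0)^-1 *: K2;
  (4 * h0)^-1 *: K3 + (4 * h0 ^+ 2)^-1 *: K4; - (4 * h0)^-1 *: K3 + (4 * h0 ^+ 2)^-1 *: K4].
pose al := [:: h0; - h0; h0 + h0; - h0 - h0].
exists 4%N, (K0 - (2 * h0 ^+ 2)^-1 *: K4), 0, 0, (fun p => nth 0 cp p), (fun=> 0),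
  (fun p => const_mx (nth 0 al p)); split.
  move=> p i j; rewrite mxE.
  have h2 : h0 + h0 != 0 by rewrite -mulr2n mulrn_eq0.
  by case: p => -[|[|[|[|p]]]] //= _; rewrite ?oppr_eq0// -opprD oppr_eq0.
move=> t i j; rewrite !big_ord_recl big_ord0 /= !mxE /= !(mulrDl _ _ t) !expCD !mulNr !expCN.
rewrite /coshC /sinhC !mulNr expCN.
have := expC_neq0 (h0 * t); move: (expC (h0 * t)) => w w0.
field; by rewrite w0 h0N.
Qed.

End Hyperbolic.

End Main.

Theorem theorem4p5 (R : realType) (n : nat) (h : 'M[Cplx R]_n -> Cplx R)
    (X0 : 'M[Cplx R]_n) :
  (1 <= n)%N ->
  GZ_hamiltonian h ->
  ~ singular_locus X0 ->
  exists gamma : Cplx R -> 'M[Cplx R]_n,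
    exp_quasipolynomial_entries gamma /\
    discrete_subset (gamma @^-1` @singular_locus R n) /\
    integral_curve h (~` (gamma @^-1` @singular_locus R n)) gamma /\
    gamma 0 = X0.
Proof.
move=> _ hH nsing.
have [L [h0 [G [M [N [ltL fd gradE]]]]]] := GZ_flow_data hH nsing.
have [h00|h0N] := eqVneq h0 0.
  (* For h0 = 0: c = 1, s = t, and all entries are polynomials in phi = t with a = 1. *)
  apply: (@flow_curve_solution R n L h h0 G M N X0 (cst 1) id (cst 1) id (cst 1)
    1 1 'X 'X 'X^2) => //.
  - by move=> t; rewrite h00 expr0n mul0r; exact: is_derive_cst.
  - by move=> t; exact: oner_neq0.
  - by move=> t; exact: oner_neq0.
  - by move=> t; rewrite !hornerE /=; split; ring.
  - exact: linear_quasipolynomial.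
have w0 (t : Cplx R) := expC_neq0 (h0 * t).
(* With phi = w = e^(h0 t), the factor a = w^-2 clears the worst pole, that of s c and s^2; the
   polynomials are w^2 times 1, c, s, s c, s^2. *)
apply: (@flow_curve_solution R n L h h0 G M N X0 (coshC h0) (sinhC h0)
  (fun t => expC (h0 * t) ^- 2) (fun t => expC (h0 * t)) (fun t => h0 * expC (h0 * t))
  'X^2 (2^-1 *: ('X^3 + 'X)) ((2 * h0)^-1 *: ('X^3 - 'X))
  ((4 * h0)^-1 *: ('X^4 - 1)) ((4 * h0 ^+ 2)^-1 *: ('X^4 - 2 *: 'X^2 + 1))) => //.
- exact: is_derive_coshC.
- exact: is_derive_sinhC.
- by rewrite /coshC !mulr0 expC0; field.
- by rewrite /sinhC !mulr0 expC0 subrr mul0r.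
- by move=> t; rewrite invr_eq0 expf_neq0.
- by move=> t; rewrite mulf_neq0.
- by move=> t; exact: is_derive_expCM.
- move=> t; rewrite !hornerE /coshC /sinhC mulNr expCN; have := w0 t; move: (expC (h0 * t)) => w.
  by move=> wN; split; rewrite /=; field; rewrite ?h0N ?wN.
- exact: (hyperbolic_quasipolynomial h0N).
Qed.
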